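(* Let $\lambda\in[0,1]$ and $T\in\mathbb{B}(\mathcal{H})$. Then $$4\lambda(1-\lambda)\|\Delta(T)\|\le\|P_{\lambda}(T)\|\le(1-2\lambda+2\lambda^2)\Big\|M_{\frac{(1-\lambda)^2}{(1-\lambda)^2+\lambda^2}}(T)\Big\|+(2\lambda-2\lambda^2)\|\Delta(T)\|.$$ In particular, $4\lambda(1-\lambda)\,r(T)\le\|P_{\lambda}(T)\|\le\|T\|$.
   Context: $\mathbb{B}(\mathcal{H})$ denotes the bounded linear operators on a complex Hilbert space $\mathcal{H}$, with operator norm $\|\cdot\|$; $r(T)$ is the spectral radius. Every $T\in\mathbb{B}(\mathcal{H})$ has a unique polar decomposition $T=U|T|$, where $|T|=(T^{*}T)^{1/2}$ and $U$ is a partial isometry with $\mathcal{N}(U)=\mathcal{N}(T)$. The Duggal transform is $T^{D}=|T|U$, the Aluthge transform is $\Delta(T)=|T|^{1/2}U|T|^{1/2}$, for $t\in[0,1]$ the weighted mean transform is $M_{t}(T)=tT+(1-t)T^{D}$, and for $\lambda\in[0,1]$ the power mean transform is $P_{\lambda}(T)=(1-\lambda)^2T+\lambda^2T^{D}+2\lambda(1-\lambda)\Delta(T)$. *)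

(* Defs.v *)
From HB Require Import structures.
From mathcomp Require Import all_boot all_order all_algebra.
From mathcomp Require Import all_classical all_reals all_analysis.
From mathcomp Require Import complex.

Set Implicit Arguments.
Unset Strict Implicit.
Unset Printing Implicit Defensive.
Import Order.TTheory GRing.Theory Num.Theory.
Import numFieldNormedType.Exports.
Local Open Scope classical_set_scope.
Local Open Scope complex_scope.
Local Open Scope ring_scope.

(* A complex Hilbert space: a Banach space over [R[i]] whose norm comes from an
   inner product.  The inner product is linear in its first argument and
   conjugate-linear in the second. *)
HB.mixin Record isHilbert (R : realType) H of CompleteNormedModule R[i] H := {
  inner : {dot H for Num.conj};
  sqr_norm_inner : forall x : H, `|x| ^+ 2 = inner x x
}.

#[short(type="hilbertType")]
HB.structure Definition Hilbert (R : realType) :=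
  {H of CompleteNormedModule R[i] H & isHilbert R H}.

Section Operators.
Variables (R : realType) (H : hilbertType R).
Implicit Types (T A S U : H -> H) (t l : R) (mu : R[i]).

(* Norms in an [R[i]]-module are [R[i]]-valued (and nonnegative real);
   [hnorm] is the same norm as an element of [R]. *)
Definition hnorm (x : H) : R := complex.Re `|x|.

Definition bounded_operator T : Prop :=
  linear T /\ exists M : R, forall x, hnorm (T x) <= M * hnorm x.

Definition opnorm T : R := sup [set hnorm (T x) | x in [set x | hnorm x <= 1]].

Definition spectrum T : set R[i] :=
  [set mu | ~ exists S, [/\ bounded_operator S,
      (forall x, S (T x - mu *: x) = x) &
      (forall x, T (S x) - mu *: S x = x)]].

(* [sup set0 = 0], so this is 0 on the zero space, whose spectra are empty. *)
Definition spectral_radius T : R :=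
  sup [set complex.Re `|mu| | mu in spectrum T].

Definition adjoint_of T S : Prop := forall x y, inner (T x) y = inner x (S y).

(* In the order of [R[i]], [0 <= z] also says that [z] is real. *)
Definition positive_operator A : Prop :=
  bounded_operator A /\ forall x, 0 <= inner (A x) x.

Definition partial_isometry U : Prop :=
  bounded_operator U /\
  forall x, (forall y, U y = 0 -> inner x y = 0) -> hnorm (U x) = hnorm x.

(* The operators below are picked by [xget] among those with their defining
   property; for bounded [T] and positive [A] there is exactly one.  The default
   value 0 only matters for other functions. *)
Definition adjoint T : H -> H := xget 0 (adjoint_of T).

Definition sqrt_op A : H -> H :=
  xget 0 [set S | positive_operator S /\ S \o S = A].

Definition abs_op T : H -> H := sqrt_op (adjoint T \o T).

Definition polar_part T : H -> H :=
  xget 0 [set U | [/\ partial_isometry U,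
                      T = U \o abs_op T &
                      forall x, U x = 0 <-> T x = 0]].

Definition duggal T : H -> H := abs_op T \o polar_part T.

Definition aluthge T : H -> H :=
  sqrt_op (abs_op T) \o polar_part T \o sqrt_op (abs_op T).

Definition weighted_mean t T : H -> H := fun x =>
  t%:C *: T x + (1 - t)%:C *: duggal T x.

Definition power_mean l T : H -> H := fun x =>
  ((1 - l) ^+ 2)%:C *: T x + (l ^+ 2)%:C *: duggal T x
    + (2 * l * (1 - l))%:C *: aluthge T x.

End Operators.

(* Main.v *)
Require Import Defs.
From mathcomp Require Import all_boot all_order all_algebra.
From mathcomp Require Import all_classical all_reals all_analysis.
From mathcomp Require Import complex ring lra.

(* Write [P := |T|], [A := P^(1/2)], [Q := P^(1/4)] and [T = U P].  The upper bounds are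
   triangle inequalities.  For the lower bound, put [Y := l A U + (1 - l) U A]; then
   [P_l(T) = l Q^2 Y + (1 - l) Y Q^2] and [Q Y Q = l Q^2 X + (1 - l) X Q^2] with
   [X := Q U Q], and [Q X Q] is the Aluthge transform.  The weighted operator AM-GM
   inequality [2 sqrt(s t) |Q Z Q| <= |s Q^2 Z + t Z Q^2|], applied to [Z = Y] and
   to [Z = X], yields the factor [4 l (1 - l)].  Finally [T = (U A) A] and
   [A (U A)] have the same nonzero spectrum, so the spectral radius of [T] is at most
   the norm of the Aluthge transform. *)

Set Implicit Arguments.
Unset Strict Implicit.
Unset Printing Implicit Defensive.
Import Order.TTheory GRing.Theory Num.Theory.
Import numFieldNormedType.Exports.
Local Open Scope classical_set_scope.
Local Open Scope complex_scope.
Local Open Scope ring_scope.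

(** * Real inner product, limits with explicit errors, Riesz representation *)

Section RealInnerProduct.
Variables (R : realType) (H : hilbertType R).
Implicit Types (x y z : H) (a b : R).

(** The power mean is an iterated mean: with [L(X) = l A X + (1 - l) X A] one has [Y = L(U)] and
    [P_l(T) = L(L(U))]. The fourth root appears because AM-GM bounds [L] from below only through a
    root of [A]; each use costs a factor [2 sqrt(l (1 - l))]. The obstacle is that an operator norm
    need not be attained, so AM-GM is run on almost singular vectors and the error is then sent to
    0. Limits are handled by explicit error sequences. Vector identities are tested against [ip],
    which is bilinear over [R], so that they become goals for [ring], [lra] or [nra]; imaginary
    parts return by multiplying a vector by [- 'i]. *)

Definition ip x y : R := complex.Re (inner x y).

Lemma innerC x y : inner x y = Num.conj (inner y x).
Proof. by rewrite hermC expr0 mul1r. Qed.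

Lemma Re_complex_conj (w : R[i]) : complex.Re (Num.conj w) = complex.Re w.
Proof. by have -> : Num.conj w = conjc w by []; case: w. Qed.

Lemma Im_complex_conj (w : R[i]) : complex.Im (Num.conj w) = - complex.Im w.
Proof. by have -> : Num.conj w = conjc w by []; case: w. Qed.

Lemma ReD (v w : R[i]) : complex.Re (v + w) = complex.Re v + complex.Re w.
Proof. by case: v; case: w. Qed.

Lemma ReN (w : R[i]) : complex.Re (- w) = - complex.Re w.
Proof. by case: w. Qed.

Lemma ReZ a (w : R[i]) : complex.Re (a%:C * w) = a * complex.Re w.
Proof. by case: w => c d /=; rewrite mul0r subr0. Qed.

Lemma ipC x y : ip x y = ip y x.
Proof. by rewrite /ip innerC Re_complex_conj. Qed.

Lemma ipDl x y z : ip (x + y) z = ip x z + ip y z.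
Proof. by rewrite /ip linearDl ReD. Qed.

Lemma ipZl a x y : ip (a%:C *: x) y = a * ip x y.
Proof. by rewrite /ip linearZl_LR /= ReZ. Qed.

Lemma ipNl x y : ip (- x) y = - ip x y.
Proof. by rewrite /ip linearNl ReN. Qed.

Lemma ipBl x y z : ip (x - y) z = ip x z - ip y z.
Proof. by rewrite ipDl ipNl. Qed.

Lemma ipDr x y z : ip z (x + y) = ip z x + ip z y.
Proof. by rewrite ipC ipDl !(ipC z). Qed.

Lemma ipZr a x y : ip y (a%:C *: x) = a * ip y x.
Proof. by rewrite ipC ipZl (ipC y). Qed.

Lemma ipNr x y : ip y (- x) = - ip y x.
Proof. by rewrite ipC ipNl ipC. Qed.

Lemma ipBr x y z : ip z (x - y) = ip z x - ip z y.
Proof. by rewrite ipDr ipNr. Qed.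

Lemma ip0l x : ip 0 x = 0.
Proof. by rewrite /ip linear0l. Qed.

Lemma ip0r x : ip x 0 = 0.
Proof. by rewrite ipC ip0l. Qed.

Definition ipE := (ipDl, ipDr, ipNl, ipNr, ipZl, ipZr, ip0l, ip0r).

Lemma norm_hnorm x : `|x| = (hnorm x)%:C.
Proof.
have : 0 <= `|x| by exact: normr_ge0.
by rewrite lecE /hnorm => /andP[/eqP]; case: `|x| => c d /= ->.
Qed.

Lemma hnorm_ge0 x : 0 <= hnorm x.
Proof. by rewrite -lecR -norm_hnorm; exact: normr_ge0. Qed.

Lemma sqr_hnorm x : hnorm x ^+ 2 = ip x x.
Proof. by rewrite /ip -sqr_norm_inner norm_hnorm -rmorphXn. Qed.

Lemma hnorm0 : hnorm (0 : H) = 0.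
Proof. by rewrite /hnorm normr0. Qed.

Lemma hnorm_eq0 x : hnorm x = 0 -> x = 0.
Proof. by move=> x0; apply/normr0_eq0; rewrite norm_hnorm x0. Qed.

Lemma hnormZ (c : R[i]) x : hnorm (c *: x) = complex.Re `|c| * hnorm x.
Proof.
rewrite /hnorm normrZ norm_hnorm /=.
by case: (`|c|) => p q /=; rewrite mulr0 subr0.
Qed.

Lemma hnormZr a x : hnorm (a%:C *: x) = `|a| * hnorm x.
Proof. by rewrite hnormZ normc_def /= expr0n /= addr0 sqrtr_sqr. Qed.

Lemma hnormN x : hnorm (- x) = hnorm x.
Proof. by rewrite /hnorm normrN. Qed.

Lemma hnormD x y : hnorm (x + y) <= hnorm x + hnorm y.
Proof. by rewrite -lecR rmorphD /= -!norm_hnorm ler_normD. Qed.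

Lemma hnormB x y : hnorm (x - y) <= hnorm x + hnorm y.
Proof. by rewrite -(hnormN y) hnormD. Qed.

Lemma hnorm_distC x y : hnorm (x - y) = hnorm (y - x).
Proof. by rewrite -hnormN opprB. Qed.

Lemma hnorm_le x a : 0 <= a -> ip x x <= a ^+ 2 -> hnorm x <= a.
Proof. by move=> a0; rewrite -sqr_hnorm ler_pXn2r ?nnegrE ?hnorm_ge0. Qed.

Lemma ip_ge0 x : 0 <= ip x x.
Proof. by rewrite -sqr_hnorm sqr_ge0. Qed.

Lemma ip_eq0 x : ip x x = 0 -> x = 0.
Proof. by rewrite -sqr_hnorm => /eqP; rewrite expf_eq0 => /eqP/hnorm_eq0. Qed.

Lemma ip_inj x y : (forall z, ip z x = ip z y) -> x = y.
Proof.
move=> xy; apply/eqP; rewrite -subr_eq0; apply/eqP/ip_eq0.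
by rewrite ipBr xy subrr.
Qed.

Lemma ip_le x y : ip x y <= hnorm x * hnorm y.
Proof.
have [x0|x0] := eqVneq (hnorm x) 0; first by rewrite (hnorm_eq0 x0) ip0l hnorm0 mul0r.
have [y0|y0] := eqVneq (hnorm y) 0; first by rewrite (hnorm_eq0 y0) ip0r hnorm0 mulr0.
have hx : 0 < hnorm x by rewrite lt_def x0 hnorm_ge0.
have hy : 0 < hnorm y by rewrite lt_def y0 hnorm_ge0.
have := ip_ge0 ((hnorm y)%:C *: x - (hnorm x)%:C *: y).
rewrite !ipE (ipC y x) -!sqr_hnorm => h.
have {}h : 0 <= 2 * (hnorm x * hnorm y) * (hnorm x * hnorm y - ip x y) by nra.
by move: h; rewrite pmulr_rge0 ?subr_ge0 // ?mulr_gt0 ?ltr0n.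
Qed.

Lemma normr_ip x y : `|ip x y| <= hnorm x * hnorm y.
Proof.
by rewrite ler_norml ip_le andbT lerNl -ipNl -(hnormN x) ip_le.
Qed.

Lemma inner_Im x y : complex.Im (inner x y) = ip ((- 'i) *: x) y.
Proof.
by rewrite /ip linearZl_LR /= mulNr ReN mulrC ReiNIm opprK.
Qed.

Lemma linop0 (T : H -> H) : linear T -> T 0 = 0.
Proof. by move=> lT; have := lT (-1) 0 0; rewrite scaler0 addr0 scaleN1r addNr. Qed.

Lemma linopZ (T : H -> H) (c : R[i]) x : linear T -> T (c *: x) = c *: T x.
Proof. by move=> lT; have := lT c x 0; rewrite (linop0 lT) !addr0. Qed.

Lemma linopD (T : H -> H) x y : linear T -> T (x + y) = T x + T y.
Proof. by move=> lT; have := lT 1 x y; rewrite !scale1r. Qed.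

Lemma linopN (T : H -> H) x : linear T -> T (- x) = - T x.
Proof. by move=> lT; rewrite -scaleN1r linopZ // scaleN1r. Qed.

Lemma linopB (T : H -> H) x y : linear T -> T (x - y) = T x - T y.
Proof. by move=> lT; rewrite linopD // linopN. Qed.

(** Applying the real identity to [(- 'i) *: x] yields the imaginary part of the complex one. *)
Lemma adjoint_of_ip (T S : H -> H) : linear T ->
  (forall x y, ip (T x) y = ip x (S y)) -> adjoint_of T S.
Proof.
move=> lT TS x y; apply/eqP; rewrite eq_complex; apply/andP; split; first exact/eqP/TS.
by rewrite !inner_Im -linopZ // TS.
Qed.

(** One-sided on purpose: these sequences only serve as upper bounds of errors. *)
Definition vanishes (e : nat -> R) := forall d, 0 < d ->
  exists N, forall n, (N <= n)%N -> e n < d.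

Lemma cauchy_converges (u : nat -> H) (e : nat -> R) : vanishes e ->
  (forall m n, (m <= n)%N -> hnorm (u m - u n) <= e m) ->
  exists l, forall n, hnorm (u n - l) <= e n.
Proof.
move=> e0 ue.
have cu : cvg (u @ \oo).
  apply/cauchy_cvgP/cauchy_exP => eps eps0.
  have eps_real : eps = (complex.Re eps)%:C.
    by move: eps0; rewrite ltcE => /andP[/eqP]; case: eps => c d /= ->.
  have {}eps0 : 0 < complex.Re eps by rewrite -ltcR -eps_real.
  have [N eN] := e0 _ eps0.
  exists (u N), N => // n /= Nn.
  rewrite -ball_normE /= eps_real norm_hnorm ltcR.
  exact: le_lt_trans (ue _ _ Nn) (eN _ (leqnn N)).
have {cu} [l cu] : exists l : H, u @ \oo --> l by exists (lim (u @ \oo)).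
exists l => n; apply/ler_addgt0Pr => d d0.
have d0C : 0 < d%:C by rewrite ltcR.
have /cvgrPdist_lt/(_ _ d0C)[N _ lN] := cu.
pose m := maxn n N.
have := lN m; rewrite /= leq_maxr => /(_ isT); rewrite norm_hnorm ltcR.
rewrite -/m => um; rewrite hnorm_distC in um.
have -> : u n - l = (u n - u m) + (u m - l).
  by rewrite addrA subrK.
apply: le_trans (hnormD _ _) _; apply: lerD; first by apply: ue; rewrite leq_maxl.
exact: ltW.
Qed.

Lemma vanishes_inv (C : R) : vanishes (fun n => C * n.+1%:R^-1).
Proof.
move=> d d0; pose c := `|C| / d.
have c0 : 0 <= c by rewrite divr_ge0 // ltW.
exists (Num.bound c) => n cn.
have n0 : 0 < n.+1%:R :> R by rewrite ltr0n.
rewrite ltr_pdivrMr //; apply: le_lt_trans (ler_norm C) _.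
rewrite mulrC -ltr_pdivrMr //; apply: lt_le_trans (archi_boundP c0) _.
by rewrite ler_nat ltnW.
Qed.

Lemma vanishes_le (e : nat -> R) a b : vanishes e -> (forall n, a <= b + e n) -> a <= b.
Proof.
move=> e0 ab; apply/ler_addgt0Pr => d /e0[N /(_ _ (leqnn N)) eN].
by apply: le_trans (ab N) _; rewrite lerD2l ltW.
Qed.

(* [u] minimises [w |-> |K w|^2 - 2 f w] in the closure of the range of [K]; the
   parallelogram identity makes minimising sequences Cauchy. *)
Lemma riesz_range (K : H -> H) (f : H -> R) M : linear K ->
  (forall x y, f (x + y) = f x + f y) ->
  (forall a x, f (a%:C *: x) = a * f x) ->
  (forall x, f x <= M * hnorm (K x)) ->
  exists u, (forall e, 0 < e -> exists w, hnorm (K w - u) < e) /\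
    forall w, f w = ip (K w) u.
Proof.
move=> lK fD fZ fM.
pose J w := ip (K w) (K w) - 2 * f w.
have infJ : has_inf (range J).
  split; first by exists (J 0), 0.
  (* [J w >= |K w|^2 - 2 M |K w| = (|K w| - M)^2 - M^2]. *)
  exists (- M ^+ 2) => _ [w _ <-]; rewrite /J -sqr_hnorm.
  have := fM w; have := sqr_ge0 (hnorm (K w) - M); nra.
pose m := inf (range J).
have mJ w : m <= J w by apply: ge_inf; [exact: infJ.2 | exists w].
pose e n : R := n.+1%:R^-1.
have e0 n : 0 < e n by rewrite invr_gt0 ltr0n.
(* A slack of [e n ^+ 2] in [J] becomes a distance [2 * e n]: [|K x - K y|^2] is [2 J x + 2 J y]
   minus four times [J] at the midpoint. *)
have ex_w n : exists w, J w < m + e n ^+ 2.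
  have [_ [w _ <-] ?] := inf_adherent (exprn_gt0 2 (e0 n)) infJ.
  by exists w.
have [w wJ] := choice ex_w.
have [u wu] : exists u, forall n, hnorm (K (w n) - u) <= 2 * e n.
  apply: cauchy_converges (vanishes_inv 2) _ => p n pn.
  apply: hnorm_le; first by rewrite mulr_ge0 // ltW.
  have en : e n <= e p by rewrite lef_pV2 ?posrE ?ltr0n // ler_nat.
  have {}en : e n ^+ 2 <= e p ^+ 2 by apply: lerXn2r; rewrite ?nnegrE // (ltW (e0 _)).
  have := mJ ((2^-1)%:C *: (w p + w n)); have := wJ p; have := wJ n.
  rewrite /J fZ fD linopZ // linopD // !ipE (ipC (K (w n)) (K (w p))) -/(e p); lra.
exists u; split.
  move=> d /(vanishes_inv 2)[N /(_ _ (leqnn N)) dN].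
  by exists (w N); apply: le_lt_trans (wu N) dN.
move=> x; apply/eqP; rewrite -subr_eq0 -normr_le0.
(* [2 |K x|] pays for replacing [K (w n)] by [u], the other terms for the first variation below. *)
pose C : R := 1 + hnorm (K x) ^+ 2 + 2 * hnorm (K x).
apply: (vanishes_le (vanishes_inv C)) => n; rewrite add0r -/(e n).
(* First variation at a near-minimiser. It is used at [t = e n] and [t = - e n]; dividing by [e n]
   leaves a bound of order [e n] on [ip (K (w n)) (K x) - f x]. *)
have var t : 0 <= e n ^+ 2 + 2 * t * (ip (K (w n)) (K x) - f x) + t ^+ 2 * hnorm (K x) ^+ 2.
  have := mJ (w n + t%:C *: x); have := wJ n.
  rewrite /J fD fZ linopD // linopZ // !ipE sqr_hnorm (ipC (K x) (K (w n))); lra.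
have := normr_ip (K (w n) - u) (K x); rewrite ipBl (ipC u).
have := var (e n); have := var (- e n); have := wu n; have := e0 n.
have := hnorm_ge0 (K x); have := hnorm_ge0 (K (w n) - u).
move: (e n) (hnorm (K x)) (hnorm (K (w n) - u)) (ip (K (w n)) (K x)) (ip (K x) u) @C => d q r g h.
move=> C r0 q0 d0 rd v1 v2 /le_trans/(_ (ler_wpM2r q0 rd)).
rewrite !ler_norml => /andP[h1 h2].
have k1 : d * (d + 2 * (g - f x) + d * q ^+ 2) >= 0 by nra.
have k2 : d * (d - 2 * (g - f x) + d * q ^+ 2) >= 0 by nra.
rewrite !pmulr_rge0 // in k1 k2; rewrite /C.
by apply/andP; split; nra.
Qed.
End RealInnerProduct.

(** * Operator norm and adjoints *)

Section BoundedOperators.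
Variables (R : realType) (H : hilbertType R).
Implicit Types (T S A : H -> H) (x y z : H) (a b : R).

Lemma bounded_operatorW T : bounded_operator T ->
  exists2 M : R, 0 < M & forall x, hnorm (T x) <= M * hnorm x.
Proof.
move=> [_ [M TM]]; exists (`|M| + 1) => [|x]; first by rewrite ltr_wpDl.
apply: le_trans (TM x) _; rewrite ler_wpM2r ?hnorm_ge0 //.
by apply: le_trans (ler_norm M) _; rewrite lerDl.
Qed.

Lemma opnorm_ub T : bounded_operator T ->
  has_sup [set hnorm (T x) | x in [set x | hnorm x <= 1]].
Proof.
move=> /[dup] -[lT _] /bounded_operatorW[M M0 TM]; split.
  by exists (hnorm (T 0)), 0 => //=; rewrite hnorm0.
exists M => _ [x /= x1 <-]; apply: le_trans (TM x) _.
by rewrite -[leRHS]mulr1 ler_pM2l.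
Qed.

Lemma opnorm_ge0 T : bounded_operator T -> 0 <= opnorm T.
Proof.
move=> bT; apply: le_trans (hnorm_ge0 (T 0)) _.
by apply: ub_le_sup (opnorm_ub bT).2 _ _; exists 0 => //=; rewrite hnorm0.
Qed.

Lemma hnorm_op T x : bounded_operator T -> hnorm (T x) <= opnorm T * hnorm x.
Proof.
move=> bT; have [lT _] := bT.
have [x0|x0] := eqVneq (hnorm x) 0.
  by rewrite (hnorm_eq0 x0) linop0 // hnorm0 mulr0.
have {}x0 : 0 < hnorm x by rewrite lt_def x0 hnorm_ge0.
rewrite -ler_pdivrMr // mulrC.
apply: ub_le_sup (opnorm_ub bT).2 _ _; exists ((hnorm x)^-1%:C *: x) => /=.
  by rewrite hnormZr ger0_norm ?mulVf ?gt_eqF // invr_ge0 ltW.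
by rewrite linopZ // hnormZr ger0_norm // invr_ge0 ltW.
Qed.

Lemma opnorm_le T M : 0 <= M -> (forall x, hnorm (T x) <= M * hnorm x) ->
  opnorm T <= M.
Proof.
move=> M0 TM; apply: ge_sup.
  by exists (hnorm (T 0)), 0 => //=; rewrite hnorm0.
move=> _ [x /= x1 <-]; apply: le_trans (TM x) _.
by rewrite -[leRHS]mulr1 ler_wpM2l.
Qed.

Lemma linear_comp T S : linear T -> linear S -> linear (T \o S).
Proof. by move=> lT lS c x y /=; rewrite lS lT. Qed.

Lemma linear_combination T S (c d : R[i]) : linear T -> linear S ->
  linear (fun x => c *: T x + d *: S x).
Proof.
move=> lT lS a x y /=; rewrite lT lS !scalerDr !scalerA addrACA.
by rewrite (mulrC c) (mulrC d).
Qed.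

Lemma bounded_comp T S : bounded_operator T -> bounded_operator S ->
  bounded_operator (T \o S).
Proof.
move=> /[dup] -[lT _] /bounded_operatorW[M M0 TM] [lS [N SN]].
split; first exact: linear_comp.
exists (M * N) => x; apply: le_trans (TM _) _.
by rewrite -mulrA ler_pM2l.
Qed.

Lemma Re_normr_ge0 (c : R[i]) : 0 <= complex.Re `|c|.
Proof. by case: c => p q; rewrite normc_def /= sqrtr_ge0. Qed.

Lemma bounded_combination T S (c d : R[i]) :
  bounded_operator T -> bounded_operator S ->
  bounded_operator (fun x => c *: T x + d *: S x).
Proof.
move=> bT bS; split; first exact: linear_combination bT.1 bS.1.
pose m (e : R[i]) := complex.Re `|e|.
exists (m c * opnorm T + m d * opnorm S) => x.
apply: le_trans (hnormD _ _) _; rewrite !hnormZ mulrDl -!mulrA -/(m c) -/(m d).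
by apply: lerD; rewrite ler_wpM2l ?hnorm_op ?Re_normr_ge0.
Qed.

Lemma adjoint_ip T S : adjoint_of T S -> forall x y, ip (T x) y = ip x (S y).
Proof. by move=> TS x y; rewrite /ip TS. Qed.

(** [|S y|^2 = <T (S y), y> <= |T| |S y| |y|], then divide by [|S y|]. *)
Lemma adjoint_hnorm T S y : bounded_operator T -> adjoint_of T S ->
  hnorm (S y) <= opnorm T * hnorm y.
Proof.
move=> bT TS.
have := ip_le (T (S y)) y; rewrite (adjoint_ip TS) -sqr_hnorm.
have := hnorm_op (S y) bT; have := hnorm_ge0 y; have := hnorm_ge0 (S y).
have := opnorm_ge0 bT.
move: (hnorm (S y)) (hnorm y) (hnorm (T (S y))) (opnorm T) => s r t m.
move=> m0 s0 r0 tm h; have [->|sn0] := eqVneq s 0; first exact: mulr_ge0.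
have {}s0 : 0 < s by rewrite lt_def sn0.
rewrite -(ler_pM2l s0) -expr2; apply: le_trans h _.
by rewrite mulrA (mulrC s) ler_wpM2r.
Qed.

Lemma adjoint_of_bounded T S : bounded_operator T -> adjoint_of T S ->
  bounded_operator S.
Proof.
move=> bT TS; split; last by exists (opnorm T) => y; apply: adjoint_hnorm.
move=> c x y; apply: ip_inj => z.
by rewrite /ip -TS !linearPr /= !TS.
Qed.

Lemma adjoint_exists T : bounded_operator T -> exists S, adjoint_of T S.
Proof.
move=> bT; have [lT _] := bT.
have ex_z y : exists z, forall x, ip (T x) y = ip x z.
  (* With the identity as [K], [riesz_range] is the usual Riesz theorem. *)
  have lI : linear (@id H) by move=> c x z.
  have [|||z [_ zP]] := riesz_range (f := fun x => ip (T x) y)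
    (M := opnorm T * hnorm y) lI.
  - by move=> x z; rewrite linopD // ipDl.
  - by move=> a x; rewrite linopZ // ipZl.
  - move=> x; apply: le_trans (ip_le _ _) _.
    by rewrite mulrAC ler_wpM2r ?hnorm_ge0 ?hnorm_op.
  - by exists z.
by have [S TS] := choice ex_z; exists S; apply: adjoint_of_ip.
Qed.

Lemma adjointP T : bounded_operator T -> adjoint_of T (adjoint T).
Proof. by move=> /adjoint_exists[S TS]; apply: (xgetPex 0); exists S. Qed.

(** Real parts only; for linear [A], [adjoint_of_ip] recovers the complex identity. *)
Definition selfadjoint A := forall x y, ip (A x) y = ip x (A y).

Lemma ip_imag x y : ip ('i *: x) ('i *: y) = ip x y.
Proof.
have ci : Num.conj ('i : R[i]) = - 'i by apply/eqP; rewrite eq_complex /= oppr0 !eqxx.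
by rewrite /ip linearZl_LR linearZr_LR /= ci mulrA mulrN -expr2 sqr_i opprK mul1r.
Qed.
End BoundedOperators.

(** * Positive operators and their square roots *)

Section SquareRoot.
Variables (R : realType) (H : hilbertType R).
Implicit Types (T S A : H -> H) (x y z : H) (a b : R).

Lemma positive_ge0 A x : positive_operator A -> 0 <= ip (A x) x.
Proof. by move=> [_ /(_ x)]; rewrite lecE => /andP[]. Qed.

(** Complex polarisation: as [inner (A z) z] is always real, the real form sending [u], [v] to
    [ip ((- 'i) *: A u) v] is antisymmetric; taking [u = 'i *: x] turns this into the symmetry of
    [A]. *)
Lemma positive_selfadjoint A : positive_operator A -> selfadjoint A.
Proof.
move=> [[lA _] pA] x y.
have im0 z : ip ((- 'i) *: A z) z = 0 by rewrite -inner_Im (ger0_Im (pA z)).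
have polar u v : ip ((- 'i) *: A u) v = - ip ((- 'i) *: A v) u.
  have := im0 (u + v); rewrite linopD // scalerDr !ipE !im0 add0r addr0 => /eqP.
  by rewrite addr_eq0 => /eqP->; rewrite opprK.
have := polar ('i *: x) y.
rewrite linopZ // scalerA mulNr -expr2 sqr_i opprK scale1r => ->.
by rewrite scaleNr ipNl opprK ip_imag ipC.
Qed.

Lemma selfadjoint_positive A : bounded_operator A -> selfadjoint A ->
  (forall x, 0 <= ip (A x) x) -> positive_operator A.
Proof.
move=> bA sA pA; split=> // x; rewrite lecE pA andbT /=.
have := innerC (A x) x; rewrite -(adjoint_of_ip bA.1 sA).
move=> /(congr1 (@complex.Im R)); rewrite Im_complex_conj => E; apply/eqP => /=.
lra.
Qed.

(** The point is [|A x|^2 <= M <A x, x>], which follows from positivity of [A] at the vector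
    [x - M^-1 A x]. *)
Lemma contraction_of_positive A M : 0 < M -> positive_operator A ->
  (forall x, hnorm (A x) <= M * hnorm x) ->
  forall x, hnorm (x - M^-1%:C *: A x) <= hnorm x.
Proof.
move=> M0 pA AM x; have [[lA _] _] := pA; have sA := positive_selfadjoint pA.
apply: hnorm_le (hnorm_ge0 _) _; rewrite sqr_hnorm !ipE.
have := positive_ge0 (x - M^-1%:C *: A x) pA.
rewrite linopB // linopZ // !ipE (sA (A x) x) (ipC x (A x)).
have : M^-1 * ip (A (A x)) (A x) <= ip (A x) (A x).
  rewrite mulrC ler_pdivrMr //; apply: le_trans (ip_le _ _) _.
  by rewrite -(sqr_hnorm (A x)) expr2 mulrAC ler_wpM2r ?hnorm_ge0 // mulrC.
have M'0 : 0 < M^-1 by rewrite invr_gt0.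
have := ip_ge0 (A x).
move: (M^-1) (ip (A (A x)) (A x)) (ip (A x) (A x)) (ip (A x) x) M'0 => q r s t q0 s0 rs h.
suff st : q * s <= t.
  have := mulr_ge0 (ltW q0) s0; have : 0 <= q * (t - q * s) by rewrite mulr_ge0 ?subr_ge0 // ltW.
  nra.
have : q * (q * r) <= q * s by rewrite ler_pM2l.
lra.
Qed.

(** * The square root of [1 - B] for a selfadjoint contraction [B] *)

Section Contraction.
Variable B : H -> H.
Hypotheses (lB : linear B) (sB : selfadjoint B)
  (B1 : forall x, hnorm (B x) <= hnorm x).

Fixpoint iter_op n : H -> H :=
  if n is n'.+1 then
    fun x => (2^-1)%:C *: (B x + iter_op n' (iter_op n' x))
  else fun=> 0.

(** The recursion of [iter_op] for the scalar [B = 1]. It dominates the norms of the iterates and of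
    their increments, and increases to its fixed point 1. *)
Fixpoint iter_maj n : R :=
  if n is n'.+1 then (1 + iter_maj n' ^+ 2) / 2 else 0.

Lemma iter_maj_bounds n : 0 <= iter_maj n <= 1.
Proof. by elim: n => [|n /andP[y0 y1]] /=; [rewrite lexx ler01 | nra]. Qed.

Lemma iter_maj_succ n : iter_maj n <= iter_maj n.+1.
Proof. by rewrite /=; have := sqr_ge0 (1 - iter_maj n); lra. Qed.

(** The defect [d = 1 - iter_maj n] evolves by [d (1 - d / 2)]. The induction runs with
    [2 / n.+2%:R], which is an equality at [n = 0] and stays at most 1, where [d (1 - d / 2)] is
    increasing. *)
Lemma iter_maj_lower n : 1 - iter_maj n <= 2 / n.+1%:R.
Proof.
suff : 1 - iter_maj n <= 2 / n.+2%:R.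
  move/le_trans; apply; rewrite ler_pM2l // lef_pV2 ?posrE ?ltr0n //.
  by rewrite ler_nat.
elim: n => [|n IH] /=; first by rewrite subr0 divff.
have /andP[y0 y1] := iter_maj_bounds n.
have n0 : 0 < n.+2%:R :> R by rewrite ltr0n.
have -> : n.+3%:R = n.+2%:R + 1 :> R by rewrite -natr1.
have k1 : 2 / (n.+2%:R : R) <= 1 by rewrite ler_pdivrMr // mul1r ler_nat.
move: k1 IH; set k := 2 / n.+2%:R => k1 IH.
have kn : k * n.+2%:R = 2 by rewrite /k divfK // gt_eqF.
rewrite ler_pdivlMr ?addr_gt0 //; move: (n.+2%:R) n0 kn => m m0 kn.
have k0 : 0 < k by rewrite -(pmulr_lgt0 _ m0) kn.
suff : k * (1 - k / 2) * (m + 1) <= 2.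
  apply: le_trans; rewrite ler_pM2r; [nra | lra].
by nra.
Qed.

Lemma iter_op_linear n : linear (iter_op n).
Proof.
elim: n => [|n IH] c x y /=; first by rewrite scaler0 addr0.
by rewrite lB !IH addrACA -scalerDr [LHS]scalerDr !scalerA (mulrC c).
Qed.

Lemma iter_op_selfadjoint n : selfadjoint (iter_op n).
Proof.
elim: n => [|n IH] x y /=; first by rewrite ip0l ip0r.
by rewrite !ipE sB !IH.
Qed.

Lemma iter_op_bound n x : hnorm (iter_op n x) <= iter_maj n * hnorm x.
Proof.
elim: n x => [|n IH] x /=; first by rewrite hnorm0 mul0r.
have /andP[y0 _] := iter_maj_bounds n.
rewrite hnormZr ger0_norm ?invr_ge0 //.
have := hnormD (B x) (iter_op n (iter_op n x)); have := B1 x.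
have := IH (iter_op n x); have := ler_wpM2l y0 (IH x).
nra.
Qed.

(** [Y^2 - Z^2 = Y (Y - Z) + (Y - Z) Z] holds for noncommuting maps and matches the scalar identity
    term by term. *)
Lemma iter_op_succ n x :
  hnorm (iter_op n.+1 x - iter_op n x) <= (iter_maj n.+1 - iter_maj n) * hnorm x.
Proof.
elim: n x => [|n IH] x.
  rewrite /= expr0n /= !subr0 !addr0 hnormZr ger0_norm ?invr_ge0 // mul1r.
  by rewrite ler_pM2l ?invr_gt0.
have /andP[y0 _] := iter_maj_bounds n; have /andP[y1 _] := iter_maj_bounds n.+1.
set Y := iter_op n.+1; set Z := iter_op n.
have -> : iter_op n.+2 x - Y x = (2^-1)%:C *: (Y (Y x - Z x) + (Y (Z x) - Z (Z x))).
  apply: ip_inj => u; rewrite /Y (linopB _ _ (@iter_op_linear _)).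
  by rewrite [iter_op n.+2]/= [iter_op n.+1 x in LHS]/= -/Z !ipE; ring.
rewrite hnormZr ger0_norm ?invr_ge0 //.
have h1 := iter_op_bound n.+1 (Y x - Z x).
have h2 := ler_wpM2l y1 (IH x).
have h3 := IH (Z x).
have d0 : 0 <= iter_maj n.+1 - iter_maj n by rewrite subr_ge0 iter_maj_succ.
have h4 := ler_wpM2l d0 (iter_op_bound n x).
have h5 := hnormD (Y (Y x - Z x)) (Y (Z x) - Z (Z x)).
have -> : iter_maj n.+2 - iter_maj n.+1 =
    (iter_maj n.+1 ^+ 2 - iter_maj n ^+ 2) / 2 by rewrite /=; field.
rewrite -/Y -/Z in h1 h2 h3 h4 h5 *; nra.
Qed.

Lemma iter_op_cauchy m n x : (m <= n)%N ->
  hnorm (iter_op m x - iter_op n x) <= (1 - iter_maj m) * hnorm x.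
Proof.
move=> mn; suff : hnorm (iter_op m x - iter_op n x) <= (iter_maj n - iter_maj m) * hnorm x.
  move/le_trans; apply; rewrite ler_wpM2r ?hnorm_ge0 // lerD2r.
  by have /andP[] := iter_maj_bounds n.
rewrite -(subnKC mn); elim: (n - m)%N => [|k IH].
  by rewrite addn0 !subrr hnorm0 mul0r.
have := iter_op_succ (m + k) x; rewrite hnorm_distC addnS.
have := hnormD (iter_op m x - iter_op (m + k) x) (iter_op (m + k) x - iter_op (m + k).+1 x).
rewrite addrA subrK; lra.
Qed.

Lemma vanishes_iter b : 0 <= b -> vanishes (fun n => (1 - iter_maj n) * b).
Proof.
move=> b0 d /(vanishes_inv (2 * b))[N dN]; exists N => n /dN.
by apply: le_lt_trans; rewrite mulrAC ler_wpM2r // iter_maj_lower.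
Qed.

(* The limit of [Y_(n+1) = (B + Y_n^2) / 2], as [(1 - Y)^2 = 1 - B]. *)
Lemma one_sub_sqrt : exists Y, [/\ linear Y, selfadjoint Y,
  forall x, hnorm (Y x) <= hnorm x & forall x, B x + Y (Y x) = 2%:C *: Y x].
Proof.
have ex_l x : exists l, forall n, hnorm (iter_op n x - l) <= (1 - iter_maj n) * hnorm x.
  apply: cauchy_converges; first exact/vanishes_iter/hnorm_ge0.
  by move=> m n; apply: iter_op_cauchy.
have [Y YP] := choice ex_l.
(* Each identity for [Y] follows by writing its defect through the errors [iter_op n x - Y x] and
   letting [n] grow. *)
have lim0 (v : H) b : 0 <= b -> (forall n, hnorm v <= (1 - iter_maj n) * b) -> v = 0.
  move=> b0 vb; apply: hnorm_eq0; apply/eqP; rewrite eq_le hnorm_ge0 andbT.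
  by apply: vanishes_le (vanishes_iter b0) _ => n; rewrite add0r.
(* At [n = 0] the iterate is zero and the error bound is [hnorm x]. *)
have Y1 x : hnorm (Y x) <= hnorm x.
  have := YP x 0%N; rewrite /= sub0r hnormN subr0 mul1r //.
exists Y; split=> //.
- move=> c x y; apply/eqP; rewrite -subr_eq0; apply/eqP.
  apply: (lim0 _ (hnorm (c *: x + y) + complex.Re `|c| * hnorm x + hnorm y)) => [|n].
    by rewrite !addr_ge0 ?mulr_ge0 ?hnorm_ge0 ?Re_normr_ge0.
  have -> : Y (c *: x + y) - (c *: Y x + Y y) = - (iter_op n (c *: x + y) - Y (c *: x + y))
      + c *: (iter_op n x - Y x) + (iter_op n y - Y y).
    by apply: ip_inj => u; rewrite iter_op_linear scalerBr !ipE; ring.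
  apply: le_trans (hnormD _ _) _; apply: le_trans (lerD (hnormD _ _) (lexx _)) _.
  rewrite hnormN hnormZ; have := YP (c *: x + y) n; have := YP y n.
  have := ler_wpM2l (Re_normr_ge0 c) (YP x n); nra.
- move=> x y; apply/eqP; rewrite -subr_eq0 -normr_le0.
  have b0 : 0 <= 2 * (hnorm x * hnorm y) by rewrite !mulr_ge0 ?hnorm_ge0.
  apply: vanishes_le (vanishes_iter b0) _ => n; rewrite add0r.
  have -> : ip (Y x) y - ip x (Y y) =
      ip x (iter_op n y - Y y) - ip (iter_op n x - Y x) y.
    by rewrite !ipE iter_op_selfadjoint; ring.
  apply: le_trans (ler_normB _ _) _.
  have := ler_wpM2r (hnorm_ge0 y) (YP x n); have := ler_wpM2l (hnorm_ge0 x) (YP y n).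
  have := normr_ip x (iter_op n y - Y y); have := normr_ip (iter_op n x - Y x) y; nra.
- move=> x; apply/eqP; rewrite -subr_eq0; apply/eqP.
  apply: (lim0 _ (6 * hnorm x)) => [|n]; first by rewrite mulr_ge0 ?hnorm_ge0.
  have /andP[y0 y1] := iter_maj_bounds n; have /andP[z0 z1] := iter_maj_bounds n.+1.
  pose Z := iter_op n.
  have -> : B x + Y (Y x) - 2%:C *: Y x = 2%:C *: (iter_op n.+1 x - Y x)
      - (Z (Z x - Y x) + (Z (Y x) - Y (Y x))).
    apply: ip_inj => u; rewrite /Z (linopB _ _ (@iter_op_linear _)).
    by rewrite /= !ipE; field.
  apply: le_trans (hnormB _ _) _; apply: le_trans (lerD (lexx _) (hnormD _ _)) _.
  rewrite hnormZr ger0_norm //.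
  have := YP x n; have := YP x n.+1; have := YP (Y x) n; have := iter_op_bound n (Z x - Y x).
  have := Y1 x; have := hnorm_ge0 (Z x - Y x); have := hnorm_ge0 x.
  have := ler_wpM2r (hnorm_ge0 x) (iter_maj_succ n).
  rewrite -/Z => h1 h2 h3 h4 h5 h6 h7 h8.
  have h9 : (1 - iter_maj n) * hnorm (Y x) <= (1 - iter_maj n) * hnorm x.
    by rewrite ler_wpM2l // subr_ge0.
  have h10 : hnorm (Z (Z x - Y x)) <= hnorm (Z x - Y x) by nra.
  nra.
Qed.
End Contraction.

(** With [B = 1 - A / M] and [Y = 1 - sqrt(1 - B)], the root is [S = sqrt M (1 - Y)]: then
    [S^2 = M (1 - B) = A], and [S] is positive because [Y] is a contraction. *)
Lemma sqrt_exists A : positive_operator A ->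
  exists S, positive_operator S /\ S \o S = A.
Proof.
move=> pA; have [bA _] := pA; have [lA _] := bA; have sA := positive_selfadjoint pA.
have [M M0 AM] := bounded_operatorW bA.
pose B x := x - M^-1%:C *: A x.
have lB : linear B.
  move=> c x y; rewrite /B lA !scalerDr opprD addrACA scalerN !scalerA.
  by rewrite (mulrC c).
have sB : selfadjoint B by move=> x y; rewrite /B !ipE sA.
have [Y [lY sY Y1 YE]] := one_sub_sqrt lB sB (contraction_of_positive M0 pA AM).
pose S x := (Num.sqrt M)%:C *: (x - Y x).
exists S; split; last first.
  apply/funext => x /=; apply: ip_inj => z; rewrite /S (linopZ _ _ lY) (linopB _ _ lY).
  have -> : ip z (A x) = M * (ip z x + ip z (Y (Y x)) - 2 * ip z (Y x)).
    have <- : ip z (B x + Y (Y x)) = 2 * ip z (Y x) by rewrite YE ipZr.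
    by rewrite /B !ipE; field; rewrite gt_eqF.
  set s := Num.sqrt M; have sM : s ^+ 2 = M by apply/sqr_sqrtr/ltW.
  by rewrite -sM !ipE; ring.
apply: selfadjoint_positive.
- split.
    move=> c x y; rewrite /S lY opprD addrACA -scalerBr scalerDr !scalerA.
    by rewrite (mulrC c).
  exists (Num.sqrt M * 2) => x; rewrite /S hnormZr ger0_norm ?sqrtr_ge0 // -mulrA.
  rewrite ler_wpM2l ?sqrtr_ge0 //; have := hnormB x (Y x); have := Y1 x; lra.
- by move=> x y; rewrite /S !ipE sY.
- move=> x; rewrite /S ipZl mulr_ge0 ?sqrtr_ge0 // ipBl subr_ge0.
  apply: le_trans (ip_le _ _) _; rewrite -sqr_hnorm expr2.
  by rewrite ler_wpM2r ?hnorm_ge0.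
Qed.

Lemma sqrt_opP A : positive_operator A ->
  positive_operator (sqrt_op A) /\ sqrt_op A \o sqrt_op A = A.
Proof.
move=> /sqrt_exists ex.
exact: (@xgetPex _ _ [set S | positive_operator S /\ S \o S = A] ex).
Qed.
End SquareRoot.

(** * Closures of ranges and orthogonal projection *)

Section RangeClosure.
Variables (R : realType) (H : hilbertType R).
Implicit Types (T S A K P : H -> H) (x y z u v p : H) (a b : R).

Definition range_closure K u : Prop := forall e, 0 < e -> exists w, hnorm (K w - u) < e.

Lemma ip_conjZ (c : R[i]) x y : ip x (c *: y) = ip (Num.conj c *: x) y.
Proof. by rewrite /ip linearZl_LR linearZr_LR. Qed.

Lemma range_closure_range K w : range_closure K (K w).
Proof. by move=> e e0; exists w; rewrite subrr hnorm0. Qed.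

Lemma range_closureP K (c : R[i]) u v : linear K ->
  range_closure K u -> range_closure K v -> range_closure K (c *: u + v).
Proof.
move=> lK Ku Kv e e0; set m := complex.Re `|c|.
have m0 : 0 < m + 1 by rewrite ltr_wpDl // Re_normr_ge0.
have e2 : 0 < e / 2 by rewrite divr_gt0.
have [w wu] := Ku (e / 2 / (m + 1)) (divr_gt0 e2 m0).
have [w' wv] := Kv (e / 2) e2.
exists (c *: w + w'); rewrite lK.
have -> : c *: K w + K w' - (c *: u + v) = c *: (K w - u) + (K w' - v).
  by rewrite scalerBr opprD addrACA.
apply: le_lt_trans (hnormD _ _) _; rewrite hnormZ -/m.
move: wu; rewrite ltr_pdivlMr // => wu.
have := hnorm_ge0 (K w - u); nra.
Qed.

Lemma range_closure_ip K u z b : range_closure K u ->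
  (forall w, ip (K w) z = b) -> ip u z = b.
Proof.
move=> Ku Kz; apply/eqP; rewrite -subr_eq0 -normr_le0.
apply: vanishes_le (vanishes_inv (hnorm z)) _ => n; rewrite add0r.
have [|w wu] := Ku n.+1%:R^-1; first by rewrite invr_gt0 ltr0n.
rewrite -(Kz w) distrC -ipBl mulrC; apply: le_trans (normr_ip _ _) _.
by rewrite ler_wpM2r ?hnorm_ge0 // ltW.
Qed.

Lemma range_closure_orthogonal K u : range_closure K u ->
  (forall w, ip (K w) u = 0) -> u = 0.
Proof. by move=> Ku /(range_closure_ip Ku)/ip_eq0. Qed.

Lemma range_closure_isometry K V u : bounded_operator V ->
  (forall w, hnorm (V (K w)) = hnorm (K w)) -> range_closure K u ->
  hnorm (V u) = hnorm u.
Proof.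
move=> bV VK Ku; apply/eqP; rewrite -subr_eq0 -normr_le0.
apply: vanishes_le (vanishes_inv (opnorm V + 1)) _ => n; rewrite add0r.
have [|w wu] := Ku n.+1%:R^-1; first by rewrite invr_gt0 ltr0n.
have := hnorm_op (K w - u) bV; rewrite (linopB _ _ bV.1).
have := hnormD (V u) (V (K w) - V u); have := hnormB (V (K w)) (V (K w) - V u).
have := hnormD u (K w - u); have := hnormB (K w) (K w - u).
rewrite !subKr !subrKC VK.
have := opnorm_ge0 bV; have := hnorm_ge0 (K w - u); have := wu.
move: (hnorm (K w - u)) (hnorm (K w)) (opnorm V) (n.+1%:R^-1) => d q r k d1 d0 r0 h1 h2 h3 h4 h5.
have h6 : r * d <= r * k by rewrite ler_wpM2l // ltW.
by rewrite ler_norml mulrDl mul1r; apply/andP; split; lra.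
Qed.

(** The Riesz vector of [w |-> <K w, x>] in the closure of the range is the orthogonal projection of
    [x]. *)
Lemma range_projection K x : linear K ->
  exists p, range_closure K p /\ forall w, ip (K w) (x - p) = 0.
Proof.
move=> lK; have [|||p [Kp pP]] := riesz_range (f := fun w => ip (K w) x) (M := hnorm x) lK.
- by move=> u v; rewrite (linopD _ _ lK) ipDl.
- by move=> a u; rewrite (linopZ _ _ lK) ipZl.
- by move=> w; rewrite mulrC ip_le.
by exists p; split=> // w; rewrite ipBr pP subrr.
Qed.

(** For selfadjoint [A] the orthogonal complement of the range is the kernel. *)
Lemma selfadjoint_decomposition A x : linear A -> selfadjoint A ->
  exists p, [/\ range_closure A p, A (x - p) = 0, ip p (x - p) = 0 & hnorm p <= hnorm x].
Proof.
move=> lA sA; have [p [Ap orth]] := range_projection x lA.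
have pp := range_closure_ip Ap orth.
exists p; split=> //.
  by apply: ip_inj => z; rewrite -sA orth ip0r.
apply: hnorm_le (hnorm_ge0 _) _; have := ip_ge0 (x - p).
by rewrite sqr_hnorm; move: pp; rewrite !ipE (ipC x p); lra.
Qed.
End RangeClosure.

(** * The polar decomposition *)

Section PolarDecomposition.
Variables (R : realType) (H : hilbertType R).
Variable T : H -> H.
Hypothesis bT : bounded_operator T.
Let lT : linear T := bT.1.

Lemma positive_gram : positive_operator (adjoint T \o T).
Proof.
have TT := adjointP bT.
apply: selfadjoint_positive.
- exact: bounded_comp (adjoint_of_bounded bT TT) bT.
- by move=> x y /=; rewrite ipC -!(adjoint_ip TT) ipC.
- by move=> x /=; rewrite ipC -(adjoint_ip TT) ip_ge0.
Qed.

Local Notation P := (abs_op T).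

Lemma abs_op_positive : positive_operator P.
Proof. exact: (sqrt_opP positive_gram).1. Qed.

Lemma abs_op_linear : linear P.
Proof. exact: abs_op_positive.1.1. Qed.

Lemma abs_op_selfadjoint : selfadjoint P.
Proof. exact: positive_selfadjoint abs_op_positive. Qed.

(** This is what makes [P x |-> T x] a well-defined isometry, which the polar part extends. *)
Lemma ip_abs_op x y : ip (P x) (P y) = ip (T x) (T y).
Proof.
have PP : P \o P = adjoint T \o T := (sqrt_opP positive_gram).2.
rewrite abs_op_selfadjoint (adjoint_ip (adjointP bT)).
by rewrite -[P (P y)]/((P \o P) y) PP.
Qed.

Lemma hnorm_abs_op x : hnorm (P x) = hnorm (T x).
Proof.
by apply/eqP; rewrite -(@eqrXn2 _ 2) ?hnorm_ge0 // !sqr_hnorm ip_abs_op.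
Qed.

Lemma abs_op_eq0 x : P x = 0 <-> T x = 0.
Proof.
by split=> Z; apply: hnorm_eq0; [rewrite -hnorm_abs_op | rewrite hnorm_abs_op];
  rewrite Z hnorm0.
Qed.

(* [U x] represents [T w |-> <|T| w, x>] on the closure of the range of [T]. *)
Lemma polar_exists : exists U, [/\ partial_isometry U, T = U \o P &
  forall x, U x = 0 <-> T x = 0].
Proof.
have lP := abs_op_linear; have sP := abs_op_selfadjoint.
have ex_u x : exists u, range_closure T u /\ forall w, ip (P w) x = ip (T w) u.
  apply: (riesz_range (f := fun w => ip (P w) x) (M := hnorm x) lT).
  - by move=> u v; rewrite (linopD _ _ lP) ipDl.
  - by move=> a u; rewrite (linopZ _ _ lP) ipZl.
  - by move=> w; rewrite -hnorm_abs_op mulrC ip_le.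
have [U UP] := choice ex_u.
(* The representing vector is unique in the closure of the range, so every property of [U] reduces
   to exhibiting such a vector. *)
have uniq x u : range_closure T u -> (forall w, ip (P w) x = ip (T w) u) -> U x = u.
  move=> Tu xu; apply/eqP; rewrite -subr_eq0; apply/eqP.
  rewrite -[U x - u](addrC (- u)) -scaleN1r.
  apply: range_closure_orthogonal; first by apply: range_closureP => //; apply: (UP x).1.
  by move=> w; rewrite scaleN1r ipDr ipNr -xu -(UP x).2 addNr.
have lU : linear U.
  move=> c x y; apply: uniq.
    by apply: range_closureP => //; [apply: (UP x).1 | apply: (UP y).1].
  move=> w; rewrite !ipDr -(UP y).2; congr (_ + _).
  by rewrite !ip_conjZ -(linopZ _ _ lP) (UP x).2 (linopZ _ _ lT).
have UPT x : U (P x) = T x.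
  by apply: uniq => [|w]; [apply: range_closure_range | rewrite ip_abs_op].
have U0 x : U x = 0 <-> T x = 0.
  rewrite -abs_op_eq0; split=> Z.
    by apply: ip_inj => w; rewrite -sP (UP x).2 Z !ip0r.
  by apply: uniq => [|w]; [rewrite -(linop0 lT); apply: range_closure_range
    | rewrite sP Z !ip0r].
(* If [T w] is close to [U x], then [|U x|^2] is close to [<T w, U x> = <P w, x>], which is at most
   [|T w| |x|]. *)
have bU : bounded_operator U.
  split=> //; exists 1 => x; rewrite mul1r.
  have [Ux0|Ux0] := eqVneq (hnorm (U x)) 0; first by rewrite Ux0 hnorm_ge0.
  have {}Ux0 : 0 < hnorm (U x) by rewrite lt_def Ux0 hnorm_ge0.
  rewrite -(ler_pM2l Ux0) -expr2 sqr_hnorm.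
  pose C := 1 * hnorm (U x) + hnorm x.
  apply: vanishes_le (vanishes_inv C) _ => n.
  have [|w wu] := (UP x).1 n.+1%:R^-1; first by rewrite invr_gt0 ltr0n.
  have -> : ip (U x) (U x) = ip (P w) x - ip (T w - U x) (U x).
    by rewrite (UP x).2 ipBl subKr.
  have := ip_le (P w) x; rewrite hnorm_abs_op.
  have := normr_ip (T w - U x) (U x); rewrite ler_norml => /andP[].
  have := hnormD (T w - U x) (U x); rewrite subrK /C.
  have := hnorm_ge0 x; have := ltW wu.
  move: (hnorm (T w - U x)) (hnorm (U x)) (hnorm x) (n.+1%:R^-1) Ux0 => d q r e.
  move=> q0 de r0 h1 h2 h3 h4.
  have h5 : hnorm (T w) * r <= (d + q) * r by rewrite ler_wpM2r.
  have h6 : d * q <= e * q by rewrite ler_wpM2r // ltW.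
  have h7 : d * r <= e * r by rewrite ler_wpM2r.
  lra.
exists U; split=> //; last by apply/funext => x /=; rewrite UPT.
split=> // x xU.
(* [x] is orthogonal to the kernel of [U], which is that of [P] and contains [x - p]. Hence [x = p]
   lies in the closure of the range of [P], where [U] is isometric. *)
have [p [Pp Pxp pxp _]] := selfadjoint_decomposition x lP sP.
have -> : x = p.
  apply/eqP; rewrite -subr_eq0; apply/eqP/ip_eq0; rewrite ipBl pxp subr0.
  by rewrite /ip xU //; apply/U0/abs_op_eq0.
by apply: range_closure_isometry Pp => // w; rewrite UPT hnorm_abs_op.
Qed.

Lemma polar_partP : [/\ partial_isometry (polar_part T), T = polar_part T \o P &
  forall x, polar_part T x = 0 <-> T x = 0].
Proof.
exact: (@xgetPex _ _ [set U | [/\ partial_isometry U, T = U \o P &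
  forall x, U x = 0 <-> T x = 0]] polar_exists).
Qed.

Lemma polar_part_bounded : bounded_operator (polar_part T).
Proof. by have [[]] := polar_partP. Qed.

Lemma polar_partE x : polar_part T (P x) = T x.
Proof. by have [_ E _] := polar_partP; rewrite [in RHS]E. Qed.

Lemma polar_part_contraction x : hnorm (polar_part T x) <= hnorm x.
Proof.
have [_ _ U0] := polar_partP; have bU := polar_part_bounded.
have [p [Pp Pxp _ px]] := selfadjoint_decomposition x abs_op_linear abs_op_selfadjoint.
rewrite -[x in polar_part T x](subrK p) (linopD _ _ bU.1).
rewrite (U0 _).2 ?add0r; last exact/abs_op_eq0.
rewrite (range_closure_isometry bU _ Pp) // => w.
by rewrite polar_partE hnorm_abs_op.
Qed.
End PolarDecomposition.

(** * The weighted operator AM-GM inequality and bounds on the spectrum *)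

Section NormInequality.
Variables (R : realType) (H : hilbertType R).
Implicit Types (T S A B C X D : H -> H) (x y z v w : H) (s t e : R).

(* A vector almost maximising [|C v|] is almost an eigenvector of [C^* C]. *)
Lemma almost_singular_vector C S e : bounded_operator C -> adjoint_of C S ->
  0 < opnorm C -> 0 < e ->
  exists v, [/\ hnorm v <= 1, opnorm C / 2 <= hnorm (C v) &
    hnorm (S (C v) - (opnorm C ^+ 2)%:C *: v) <= e].
Proof.
move=> bC CS; set m := opnorm C => m0 e0.
(* The first bound keeps [|C v|] above [m / 2]. The second comes from [|S (C v) - m^2 v|^2 <= m^2
   (m^2 - |C v|^2) <= 2 m^3 d]. *)
pose d := Num.min (m / 2) (e ^+ 2 / (2 * m ^+ 3)).
have m3 : 0 < 2 * m ^+ 3 by rewrite mulr_gt0 // exprn_gt0.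
have d0 : 0 < d by rewrite lt_min !divr_gt0 // exprn_gt0.
have dm : d <= m / 2 by rewrite ge_min lexx.
have de : 2 * m ^+ 3 * d <= e ^+ 2 by rewrite mulrC -ler_pdivlMr // ge_min lexx orbT.
have [_ [v /= v1 <-] vd] := sup_adherent d0 (opnorm_ub bC).
rewrite -/(opnorm C) -/m in vd.
exists v; split=> //; first lra.
apply: hnorm_le; first exact: ltW.
apply: le_trans de; rewrite !ipE -(sqr_hnorm v) -(sqr_hnorm (S (C v))).
rewrite (ipC (S (C v)) v) -!(adjoint_ip CS) -(sqr_hnorm (C v)).
have := adjoint_hnorm (C v) bC CS; rewrite -/m.
have := hnorm_op v bC; rewrite -/m.
have := hnorm_ge0 v; have := hnorm_ge0 (C v); have := hnorm_ge0 (S (C v)).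
move: (hnorm v) (hnorm (C v)) (hnorm (S (C v))) v1 vd => p q r p1 qm r0 q0 p0 qp rq.
have h1 : r ^+ 2 <= m ^+ 2 * q ^+ 2 by rewrite -exprMn lerXn2r ?nnegrE ?mulr_ge0 // ltW.
have h2 : (m ^+ 2) ^+ 2 * p ^+ 2 <= (m ^+ 2) ^+ 2.
  by rewrite -[leRHS]mulr1 ler_wpM2l ?sqr_ge0 // expr_le1.
have h3 : m ^+ 2 * (m ^+ 2 - q ^+ 2) <= m ^+ 2 * (2 * m * d).
  by rewrite ler_wpM2l ?sqr_ge0 //; nra.
lra.
Qed.

(* With [C = A X B], [C^* C v = |C|^2 v] and [w1 = B v], [w2 = A C v], one has
   [<(s A^2 X + t X B^2) w1, w2> = s |w2|^2 + t |C|^2 |w1|^2], to which AM-GM applies;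
   such a [v] only exists up to an error [e]. *)
Lemma weighted_arithmetic_geometric_mean A B X s t : 0 <= s -> 0 <= t ->
  bounded_operator A -> bounded_operator B -> bounded_operator X ->
  selfadjoint A -> selfadjoint B ->
  2 * Num.sqrt (s * t) * opnorm (A \o X \o B) <=
    opnorm (fun x => s%:C *: A (A (X x)) + t%:C *: X (B (B x))).
Proof.
move=> s0 t0 bA bB bX sA sB.
set C := A \o X \o B; set Z := (fun x => _).
have bC : bounded_operator C := bounded_comp (bounded_comp bA bX) bB.
have bZ : bounded_operator Z.
  exact: bounded_combination (bounded_comp bA (bounded_comp bA bX))
    (bounded_comp bX (bounded_comp bB bB)).
have XX := adjointP bX; set X' := adjoint X in XX.
have bX' := adjoint_of_bounded bX XX.
pose S := B \o X' \o A.
have CS : adjoint_of C S.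
  by apply: adjoint_of_ip bC.1 _ => x y; rewrite /C /S /= sA (adjoint_ip XX) sB.
have [m0|mn0] := eqVneq (opnorm C) 0; first by rewrite m0 mulr0 opnorm_ge0.
have {mn0}m0 : 0 < opnorm C by rewrite lt_def mn0 opnorm_ge0.
set g := Num.sqrt _.
have g0 : 0 <= g := sqrtr_ge0 _.
set m := opnorm C in m0 *; set z := opnorm Z.
have b0 : 0 <= opnorm B := opnorm_ge0 bB.
have x0 : 0 <= opnorm X' := opnorm_ge0 bX'.
(* The error [t |B| e] in [key], divided by the lower bound for [|w2|] in [w2_low], is [K e]. *)
pose K := 4 * (opnorm B * opnorm X') * (t * opnorm B) / m ^+ 2.
apply: (vanishes_le (vanishes_inv K)) => n.
set e : R := n.+1%:R^-1; have e0 : 0 < e by rewrite invr_gt0 ltr0n.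
have [v [v1 Cv Ce]] := almost_singular_vector bC CS m0 e0; rewrite -/m in Cv Ce.
pose w1 := B v; pose w2 := A (C v).
pose err := S (C v) - (m ^+ 2)%:C *: v.
have form : s * hnorm w2 ^+ 2 + t * m ^+ 2 * hnorm w1 ^+ 2 + t * ip w1 (B err) = ip (Z w1) w2.
  have -> : Z w1 = s%:C *: w2 + t%:C *: X (B (B w1)) by [].
  rewrite !ipE (adjoint_ip XX) sB sB -[B (X' w2)]/(S (C v)) !sqr_hnorm.
  by rewrite /err (linopB _ _ bB.1) (linopZ _ _ bB.1) -/w1 !ipE; ring.
have w1_gt0 : 0 < hnorm w1.
  rewrite lt_def hnorm_ge0 andbT; apply/eqP => /hnorm_eq0 w10.
  by move: Cv; rewrite /C /= -/w1 w10 (linop0 bX.1) (linop0 bA.1) hnorm0; lra.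
(* [m^2 / 4 <= |C v|^2 = <v, B (X' w2)>]. This bound is uniform in [e], so [|w2|] can be divided out
   in the limit. *)
have w2_low : m ^+ 2 <= 4 * (opnorm B * opnorm X') * hnorm w2.
  have := hnorm_op (X' w2) bB; rewrite -[B (X' w2)]/(S (C v)).
  have := ler_wpM2l b0 (hnorm_op w2 bX').
  have := ip_le v (S (C v)); rewrite -(adjoint_ip CS) -sqr_hnorm.
  have := ler_wpM2r (hnorm_ge0 (S (C v))) v1.
  have : (m / 2) ^+ 2 <= hnorm (C v) ^+ 2.
    by rewrite lerXn2r ?nnegrE ?hnorm_ge0 // divr_ge0 // ltW.
  lra.
(* Every term, the error included, carries a factor [|w1|], which cancels whatever its size. *)
have key : (2 * g * m - z) * hnorm w2 <= t * opnorm B * e.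
  rewrite -(ler_pM2r w1_gt0).
  have agm : 2 * g * m * (hnorm w1 * hnorm w2) <= s * hnorm w2 ^+ 2 + t * m ^+ 2 * hnorm w1 ^+ 2.
    have := sqr_ge0 (Num.sqrt s * hnorm w2 - Num.sqrt t * m * hnorm w1).
    rewrite /g sqrtrM //; have := sqr_sqrtr s0; have := sqr_sqrtr t0.
    move: (Num.sqrt s) (Num.sqrt t) (hnorm w1) (hnorm w2) => p q a b <- <-.
    by move=> h; rewrite -subr_ge0 (_ : _ - _ = (p * b - q * m * a) ^+ 2) //; ring.
  have := ip_le (Z w1) w2; have := ler_wpM2r (hnorm_ge0 w2) (hnorm_op w1 bZ).
  have := normr_ip w1 (B err); rewrite ler_norml => /andP[h _].
  have h1 : hnorm (B err) <= opnorm B * e.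
    by apply: le_trans (hnorm_op _ bB) _; rewrite ler_wpM2l.
  have h2 := ler_wpM2l t0 (ler_wpM2l (ltW w1_gt0) h1).
  have h3 := ler_wpM2l t0 h; rewrite -form -/z; lra.
have [D0|D0] := leP (2 * g * m) z.
  apply: le_trans D0 _; rewrite lerDl mulr_ge0 ?(ltW e0) //.
  by rewrite /K divr_ge0 ?exprn_ge0 ?mulr_ge0 // ltW.
rewrite -lerBlDl /K [leRHS]mulrAC ler_pdivlMr ?exprn_gt0 //.
have D1 : 0 <= 2 * g * m - z by rewrite subr_ge0 ltW.
apply: le_trans (ler_wpM2l D1 w2_low) _.
have bx : 0 <= 4 * (opnorm B * opnorm X') by rewrite !mulr_ge0.
have := ler_wpM2l bx key; lra.
Qed.

(** The lower bound closes the range, since preimages of a convergent sequence are Cauchy; the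
    orthogonality condition makes it dense. *)
Lemma bounded_below_surjective K c : bounded_operator K -> 0 < c ->
  (forall x, c * hnorm x <= hnorm (K x)) ->
  (forall z, (forall w, ip (K w) z = 0) -> z = 0) -> forall y, exists x, K x = y.
Proof.
move=> bK c0 Kc dense y; have lK : linear K := bK.1.
have [p [Kp /dense yp]] := range_projection y lK.
have {yp}p_y : p = y by apply/esym/eqP; rewrite -subr_eq0 yp.
rewrite {}p_y in Kp.
have ex_w n : exists w, hnorm (K w - y) < n.+1%:R^-1.
  by apply: Kp; rewrite invr_gt0 ltr0n.
have [w wP] := choice ex_w.
have [x xP] : exists x, forall n, hnorm (w n - x) <= 2 / c * n.+1%:R^-1.
  apply: cauchy_converges (vanishes_inv _) _ => m n mn.
  rewrite mulrAC ler_pdivlMr // mulrC; apply: le_trans (Kc _) _.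
  have -> : K (w m - w n) = (K (w m) - y) - (K (w n) - y).
    by rewrite (linopB _ _ lK) opprB addrA subrK.
  apply: le_trans (hnormB _ _) _.
  have : n.+1%:R^-1 <= m.+1%:R^-1 :> R by rewrite lef_pV2 ?posrE ?ltr0n // ler_nat.
  by have := wP m; have := wP n; move: (n.+1%:R^-1) (m.+1%:R^-1) => a b; lra.
exists x; apply/eqP; rewrite -subr_eq0; apply/eqP/hnorm_eq0/eqP.
rewrite eq_le hnorm_ge0 andbT.
apply: (vanishes_le (vanishes_inv (opnorm K * (2 / c) + 1))) => n; rewrite add0r.
have -> : K x - y = (K (w n) - y) - K (w n - x).
  by rewrite (linopB _ _ lK) opprB [RHS]addrC addrA subrK.
apply: le_trans (hnormB _ _) _; rewrite mulrDl mul1r addrC.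
apply: lerD; last exact/ltW/wP.
apply: le_trans (hnorm_op _ bK) _.
by rewrite -mulrA ler_wpM2l ?opnorm_ge0.
Qed.

Lemma bounded_id : bounded_operator (@id H).
Proof. by split=> //; exists 1 => x; rewrite mul1r. Qed.

Lemma bounded_shift D (mu : R[i]) : bounded_operator D ->
  bounded_operator (fun x => D x - mu *: x).
Proof.
move=> bD; have := bounded_combination 1 (- mu) bD bounded_id.
rewrite (_ : (fun x => _) = (fun x => D x - mu *: x)) //.
by apply/funext => x; rewrite scale1r scaleNr.
Qed.

(** If [|mu| > |D|], then [D - mu] is bounded below by [|mu| - |D|] and has dense range, hence a
    bounded inverse. *)
Lemma spectrum_le_opnorm D (mu : R[i]) : bounded_operator D ->
  spectrum D mu -> complex.Re `|mu| <= opnorm D.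
Proof.
move=> bD; apply: contraPT; rewrite -ltNge => Dmu; apply; move: Dmu.
set a := complex.Re `|mu| => Dmu.
pose K x := D x - mu *: x; have bK : bounded_operator K := bounded_shift mu bD.
have a0 : 0 < a := le_lt_trans (opnorm_ge0 bD) Dmu.
have mu0 : mu != 0 by apply: contraTneq a0 => mu0; rewrite /a mu0 normr0 ltxx.
have c0 : 0 < a - opnorm D by rewrite subr_gt0.
have Kc x : (a - opnorm D) * hnorm x <= hnorm (K x).
  have := hnormB (D x) (K x); rewrite /K subKr hnormZ -/a.
  by have := hnorm_op x bD; lra.
have Kinj x y : K x = K y -> x = y.
  move=> xy; apply/eqP; rewrite -subr_eq0; apply/eqP/hnorm_eq0/eqP.
  rewrite eq_le hnorm_ge0 andbT -(ler_pM2l c0) mulr0; apply: le_trans (Kc _) _.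
  by rewrite (linopB _ _ bK.1) xy subrr hnorm0.
have dense z : (forall w, ip (K w) z = 0) -> z = 0.
  (* Orthogonality to [K w] reads [<D w, z> = |z|^2] with [|w| = |z| / |mu|], impossible for nonzero
     [z] as [|D| < |mu|]. *)
  move=> /(_ (mu^-1 *: z)); rewrite /K ipBl; set w := mu^-1 *: z.
  have zw : mu *: w = z by rewrite scalerA mulfV // scale1r.
  rewrite zw => /eqP; rewrite subr_eq0 => /eqP zz.
  apply: hnorm_eq0; apply/eqP; apply: contraTT isT => z0.
  have {}z0 : 0 < hnorm z by rewrite lt_def z0 hnorm_ge0.
  have := ip_le (D w) z; rewrite zz -sqr_hnorm expr2 ler_pM2r // => zD.
  have := hnorm_op w bD; have := hnormZ mu w; rewrite zw -/a => za wD.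
  have w0 : 0 < hnorm w by move: z0; rewrite za pmulr_rgt0.
  by move: (le_trans zD wD); rewrite za ler_pM2r // leNgt Dmu.
have [S KS] := choice (bounded_below_surjective bK c0 Kc dense).
exists S; split=> [|x|x].
- split; first by move=> e x y; apply: Kinj; rewrite bK.1 !KS.
  exists (a - opnorm D)^-1 => x.
  by rewrite mulrC ler_pdivlMr // mulrC -[in leRHS](KS x).
- by apply: Kinj; rewrite KS.
- exact: KS.
Qed.

(* If [S] inverts [Y X - mu], then [(X S Y - 1) / mu] inverts [X Y - mu]. *)
Lemma spectrum_swap X Y (mu : R[i]) : bounded_operator X -> bounded_operator Y ->
  mu != 0 -> spectrum (X \o Y) mu -> spectrum (Y \o X) mu.
Proof.
move=> bX bY mu0 XY [S [bS SK KS]]; apply: XY.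
have lX := bX.1; have lY := bY.1.
exists (fun z => mu^-1 *: X (S (Y z)) + (- mu^-1) *: z); split.
- exact: bounded_combination (bounded_comp bX (bounded_comp bS bY)) bounded_id.
- move=> x /=.
  rewrite (linopB _ _ lY) (linopZ _ _ lY) SK scaleNr -scalerBr subKr.
  by rewrite scalerA mulVf // scale1r.
- move=> z /=.
  have := KS (Y z); move=> /= /eqP; rewrite subr_eq => /eqP YXS.
  rewrite (linopD _ _ lY) !(linopZ _ _ lY) (linopD _ _ lX) !(linopZ _ _ lX) YXS.
  rewrite (linopD _ _ lX) (linopZ _ _ lX) !scaleNr !scalerDr !scalerN !scalerA.
  rewrite mulVf // mulfV // !scale1r opprB.
  by rewrite [X in X + _]addrAC subrr add0r addrC subrK.
Qed.

End NormInequality.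

(** * Duggal, Aluthge and power mean transforms *)

Section Transforms.
Variables (R : realType) (H : hilbertType R).
Variable T : H -> H.
Hypothesis bT : bounded_operator T.

Local Notation P := (abs_op T).
Local Notation U := (polar_part T).
Local Notation A := (sqrt_op P).
Local Notation Q := (sqrt_op A).

Let bU : bounded_operator U := polar_part_bounded bT.
Let pA : positive_operator A := (sqrt_opP (abs_op_positive bT)).1.
Let bA : bounded_operator A := pA.1.
Let pQ : positive_operator Q := (sqrt_opP pA).1.
Let bQ : bounded_operator Q := pQ.1.

Let AA x : A (A x) = P x.
Proof. by rewrite -[in RHS](sqrt_opP (abs_op_positive bT)).2. Qed.

Let QQ x : Q (Q x) = A x.
Proof. by rewrite -[in RHS](sqrt_opP pA).2. Qed.

Let UAA x : U (A (A x)) = T x.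
Proof. by rewrite AA polar_partE. Qed.

Lemma bounded_duggal : bounded_operator (duggal T).
Proof. exact: bounded_comp (abs_op_positive bT).1 bU. Qed.

Lemma bounded_aluthge : bounded_operator (aluthge T).
Proof. exact: bounded_comp (bounded_comp bA bU) bA. Qed.

Lemma bounded_weighted_mean t : bounded_operator (weighted_mean t T).
Proof. exact: bounded_combination bT bounded_duggal. Qed.

Lemma hnorm_duggal x : hnorm (duggal T x) <= opnorm T * hnorm x.
Proof.
rewrite /duggal /= hnorm_abs_op //; apply: le_trans (hnorm_op _ bT) _.
by rewrite ler_wpM2l ?opnorm_ge0 ?polar_part_contraction.
Qed.

Lemma hnorm_sqrt_abs x : hnorm (A x) <= Num.sqrt (opnorm T) * hnorm x.
Proof.
have T0 := opnorm_ge0 bT.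
apply: hnorm_le; first by rewrite mulr_ge0 ?sqrtr_ge0 ?hnorm_ge0.
rewrite (positive_selfadjoint pA) AA exprMn sqr_sqrtr //.
apply: le_trans (ip_le _ _) _; rewrite hnorm_abs_op // mulrC expr2 mulrA.
by rewrite ler_wpM2r ?hnorm_ge0 // hnorm_op.
Qed.

Lemma hnorm_aluthge x : hnorm (aluthge T x) <= opnorm T * hnorm x.
Proof.
rewrite /aluthge /=; apply: le_trans (hnorm_sqrt_abs _) _.
rewrite -[in leRHS](sqr_sqrtr (opnorm_ge0 bT)) expr2 -mulrA.
rewrite ler_wpM2l ?sqrtr_ge0 //; apply: le_trans (polar_part_contraction bT _) _.
exact: hnorm_sqrt_abs.
Qed.

(** The three coefficients are nonnegative with sum [((1 - l) + l)^2 = 1], and neither transform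
    exceeds [T] in norm. *)
Lemma power_mean_le l : 0 <= l <= 1 -> opnorm (power_mean l T) <= opnorm T.
Proof.
move=> /andP[l0 l1]; apply: opnorm_le (opnorm_ge0 bT) _ => x.
have l2 : 0 <= 2 * l * (1 - l) by rewrite !mulr_ge0 // subr_ge0.
apply: le_trans (hnormD _ _) _; apply: le_trans (lerD (hnormD _ _) (lexx _)) _.
rewrite !hnormZr !ger0_norm ?sqr_ge0 //.
have := ler_wpM2l (sqr_ge0 (1 - l)) (hnorm_op x bT).
have := ler_wpM2l (sqr_ge0 l) (hnorm_duggal x).
have := ler_wpM2l l2 (hnorm_aluthge x).
lra.
Qed.

Lemma power_mean_le_weighted_mean l : 0 <= l <= 1 ->
  opnorm (power_mean l T) <=
    (1 - 2 * l + 2 * l ^+ 2) *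
      opnorm (weighted_mean ((1 - l) ^+ 2 / ((1 - l) ^+ 2 + l ^+ 2)) T)
    + (2 * l - 2 * l ^+ 2) * opnorm (aluthge T).
Proof.
move=> /andP[l0 l1]; set c := 1 - 2 * l + 2 * l ^+ 2.
have -> : (1 - l) ^+ 2 + l ^+ 2 = c by rewrite /c; ring.
set t := (1 - l) ^+ 2 / c.
(* [2 c = 1 + (1 - 2 l)^2]. *)
have c0 : 0 < c by rewrite /c; have := sqr_ge0 (1 - 2 * l); lra.
have d0 : 0 <= 2 * l - 2 * l ^+ 2 by nra.
have bM := bounded_weighted_mean t.
apply: opnorm_le => [|x].
  by rewrite addr_ge0 // mulr_ge0 ?opnorm_ge0 ?(ltW c0) //; exact: bounded_aluthge.
have -> : power_mean l T x =
    c%:C *: weighted_mean t T x + (2 * l - 2 * l ^+ 2)%:C *: aluthge T x.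
  apply: ip_inj => z; rewrite /power_mean /weighted_mean !ipE /t.
  have -> : 1 - (1 - l) ^+ 2 / c = l ^+ 2 / c.
    by apply: (mulIf (lt0r_neq0 c0)); rewrite mulrBl !divfK ?gt_eqF // /c; ring.
  by field; rewrite gt_eqF.
apply: le_trans (hnormD _ _) _; rewrite !hnormZr !ger0_norm ?(ltW c0) //.
have := ler_wpM2l (ltW c0) (hnorm_op x bM).
by have := ler_wpM2l d0 (hnorm_op x bounded_aluthge); lra.
Qed.

Lemma aluthge_le_power_mean l : 0 <= l <= 1 ->
  4 * l * (1 - l) * opnorm (aluthge T) <= opnorm (power_mean l T).
Proof.
move=> /andP[l0 l1]; have m0 : 0 <= 1 - l by rewrite subr_ge0.
pose Y x := l%:C *: A (U x) + (1 - l)%:C *: U (A x).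
have bY : bounded_operator Y.
  exact: bounded_combination (bounded_comp bA bU) (bounded_comp bU bA).
have sQ := positive_selfadjoint pQ.
have agm X (bX : bounded_operator X) :=
  weighted_arithmetic_geometric_mean l0 m0 bQ bQ bX sQ sQ.
set g := Num.sqrt _ in agm; have g0 : 0 <= g := sqrtr_ge0 _.
have gg : g ^+ 2 = l * (1 - l) by rewrite sqr_sqrtr // mulr_ge0.
have outer_step : 2 * g * opnorm (Q \o Y \o Q) <= opnorm (power_mean l T).
  rewrite (_ : power_mean l T =
    fun x => l%:C *: Q (Q (Y x)) + (1 - l)%:C *: Y (Q (Q x))); first exact: agm.
  apply/funext => x; apply: ip_inj => z.
  rewrite !QQ /Y (linopD _ _ bA.1) !(linopZ _ _ bA.1) AA UAA.
  by rewrite /power_mean /duggal /aluthge /= !ipE; ring.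
(* [Q] commutes with [A = Q \o Q], so [Q \o Y \o Q] is the expression of [Y] with [X] in place of
   [U]. *)
have inner_step : 2 * g * opnorm (aluthge T) <= opnorm (Q \o Y \o Q).
  pose X := Q \o U \o Q.
  have bX : bounded_operator X := bounded_comp (bounded_comp bQ bU) bQ.
  rewrite (_ : Q \o Y \o Q =
    fun x => l%:C *: Q (Q (X x)) + (1 - l)%:C *: X (Q (Q x))).
    rewrite (_ : aluthge T = Q \o X \o Q); first exact: agm.
    by apply/funext => x; rewrite /aluthge /X /= !QQ.
  apply/funext => x; apply: ip_inj => z.
  rewrite /X /Y /= (linopD _ _ bQ.1) !(linopZ _ _ bQ.1) -!QQ.
  by rewrite !ipE; ring.
apply: le_trans outer_step; have := ler_wpM2l (mulr_ge0 (ler0n _ 2) g0) inner_step.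
apply: le_trans; have -> : 4 * l * (1 - l) = 4 * g ^+ 2 by rewrite gg; ring.
by rewrite le_eqVlt; apply/orP; left; apply/eqP; ring.
Qed.

Lemma spectral_radius_le_aluthge : spectral_radius T <= opnorm (aluthge T).
Proof.
have D0 := opnorm_ge0 bounded_aluthge.
rewrite /spectral_radius; set E := (X in sup X).
(* An empty spectrum gives [sup set0 = 0], covered by [D0]. *)
have [->|/set0P E0] := eqVneq E set0; first by rewrite sup0.
apply: ge_sup => // _ [mu muT <-].
(* Swapping the factors preserves only the nonzero spectrum, so 0 is treated apart. *)
have [->|mu0] := eqVneq mu 0; first by rewrite normr0.
apply: spectrum_le_opnorm bounded_aluthge _.
rewrite -[aluthge T]/(A \o (U \o A)).
apply: spectrum_swap (bounded_comp bU bA) bA mu0 _.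
rewrite (_ : _ \o _ = T) //; apply/funext => x /=; exact: UAA.
Qed.
End Transforms.

Theorem theorem2p12 (R : realType) (H : hilbertType R) (l : R) (T : H -> H)
    (hl : 0 <= l <= 1) (hT : bounded_operator T) :
  (4 * l * (1 - l) * opnorm (aluthge T) <= opnorm (power_mean l T) /\
   opnorm (power_mean l T) <=
     (1 - 2 * l + 2 * l ^+ 2) *
       opnorm (weighted_mean ((1 - l) ^+ 2 / ((1 - l) ^+ 2 + l ^+ 2)) T)
     + (2 * l - 2 * l ^+ 2) * opnorm (aluthge T)) /\
  (4 * l * (1 - l) * spectral_radius T <= opnorm (power_mean l T) /\
   opnorm (power_mean l T) <= opnorm T).
Proof.
have lower := aluthge_le_power_mean hT hl.
split; split=> //.
- exact: power_mean_le_weighted_mean.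
- apply: le_trans lower; have /andP[l0 l1] := hl.
  by rewrite ler_wpM2l ?spectral_radius_le_aluthge // !mulr_ge0 // subr_ge0.
- exact: power_mean_le.
Qed.
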